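(* Assume the indices $j\in[J]$ are ordered so that $\nu^j_1\ge\nu^{j-1}_1$ for all $j\in[J]$. The following lifted inequality is valid for (i.e., satisfied by every point $(x,(\gamma_k)_{k\in\Gamma},z)$ of) $\mathcal{S}_{\mathbb{B}}$: $$\max_{j\in[J]}\left\{\frac{z_j}{d^j}\right\}\ \ge\ \sum_{j=1}^J(\nu^j_1-\nu^{j-1}_1)(\tau^j_1-x^\top\bar\xi^j)+\sum_{k\in\Gamma}\alpha_k\gamma_k,$$ where, for all $k\in\Gamma$, $$\alpha_k:=\left(\min_{j\in[J]}\min\{\nu^j_k-\nu^J_1,0\}+\sum_{j=1}^J(\nu^j_1-\nu^{j-1}_1)(\tau^j_k-\tau^j_1)\right)^+,$$ $\tau^j_k:=\left\lceil-\frac{r_k+d^j_0}{d^j}\right\rceil$, $\nu^0_1:=0$, and $\nu^j_k:=-\frac{r_k+d^j_0}{d^j}-(\tau^j_k-1)$.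
   Context: Notation: $[m]=\{1,\dots,m\}$; $(t)^+=\max\{t,0\}$; $\mathbb{R}_-$ is the set of nonpositive reals; $\mathbf 1$ is the all-ones vector. Let $J$ be a positive integer and, for $j\in[J]$, let $d^j_0\in\mathbb{R}$, $d^j<0$, $\bar\xi^j\in\{0,1\}^n$ be given constants. The numbers $r_k$, $k\in\Gamma=\{1,\dots,|\Gamma|\}$, are the elements of the (nonempty) finite set $$\left\{r\in\mathbb{R}:\ \left\lceil(\delta/\epsilon)^p\right\rceil^{1/p}\le r\le-\mathrm{VaR}_{1-\epsilon}(-g(\mathbf{1},\hat\xi)),\ r^p\in[n]\right\},$$ enumerated so that $r_1$ is the smallest element. Here $\delta>0$, $\epsilon\in(0,1)$, $p\ge1$, $g(x,\xi)=\min_{i\in[I]}\left((x^\top\xi_i-v_i+1)^+\right)^{1/p}$ with integers $v_i\ge1$ ($\xi_i$ is the $i$-th row of $\xi\in\{0,1\}^{I\times n}$), $\hat\xi$ is uniformly distributed on given samples $\hat\xi^1,\dots,\hat\xi^N\in\{0,1\}^{I\times n}$, and $\mathrm{VaR}_{1-\epsilon}(\tilde X)=\inf\{t:\mathbb{P}\{\tilde X\le t\}\ge1-\epsilon\}$. The set $\mathcal{S}_{\mathbb{B}}$ is $$\mathcal{S}_{\mathbb{B}}:=\left\{(x,\gamma,z)\in\{0,1\}^{n}\times\{0,1\}^{|\Gamma|}\times\mathbb{R}^J_-:\ -z_j-\sum_{k\in\Gamma}r_k\gamma_k\ge d^j(x^\top\bar\xi^j)+d^j_0\ \ \forall j\in[J],\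 \ \sum_{k\in\Gamma}\gamma_k=1\right\}.$$ *)

(* Defs.v *)
From HB Require Import structures.
From mathcomp Require Import all_boot all_order all_algebra.
From mathcomp Require Import all_classical all_reals all_analysis.

Set Implicit Arguments.
Unset Strict Implicit.
Unset Printing Implicit Defensive.

Import Order.TTheory GRing.Theory Num.Theory.
Local Open Scope classical_set_scope.
Local Open Scope ring_scope.

(* A nonempty index set {1, .., m+1} is represented by 'I_m.+1, so index 1 is
   ord0 and the last index is ord_max.  Vectors are row vectors. *)

Definition min_ord (R : realType) m (F : 'I_m.+1 -> R) : R :=
  \big[Num.min/F ord0]_(i < m.+1) F i.

Definition max_ord (R : realType) m (F : 'I_m.+1 -> R) : R :=
  \big[Num.max/F ord0]_(i < m.+1) F i.

Definition pos_part (R : realType) (t : R) : R := Num.max t 0.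

Definition dot (R : realType) n (u v : 'rV[R]_n) : R := (u *m v^T) 0 0.

Definition binary (R : realType) m n (A : 'M[R]_(m, n)) : Prop :=
  forall i j, A i j = 0 \/ A i j = 1.

Definition unif_prob (R : realType) N (E : pred 'I_N.+1) : R :=
  #|[set s | E s]%SET|%:R / N.+1%:R.

(* X s is the value of the random variable at the s-th equiprobable sample. *)
Definition VaR (R : realType) N (a : R) (X : 'I_N.+1 -> R) : R :=
  inf [set t | a <= unif_prob R (fun s => X s <= t)].

Definition g (R : realType) m n (p : R) (v : 'I_m.+1 -> int)
    (x : 'rV[R]_n) (xi : 'M[R]_(m.+1, n)) : R :=
  min_ord (fun i => pos_part (dot x (row i xi) - (v i)%:~R + 1) `^ p^-1).

(* Since 0 < delta / eps, the lower bound is positive, so r `^ p is only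
   evaluated at relevant r > 0; powR is not a genuine power on r < 0. *)
Definition radii (R : realType) m n N (delta eps p : R) (v : 'I_m.+1 -> int)
    (xihat : 'I_N.+1 -> 'M[R]_(m.+1, n)) : set R :=
  [set r | [/\ (Num.ceil ((delta / eps) `^ p))%:~R `^ p^-1 <= r,
               r <= - VaR (1 - eps) (fun s => - g p v (const_mx 1) (xihat s))
             & exists2 q : nat, (1 <= q <= n)%N & r `^ p = q%:R]].

Definition S_B (R : realType) n J K (d0 d : 'I_J.+1 -> R)
    (xibar : 'I_J.+1 -> 'rV[R]_n) (r : 'I_K.+1 -> R) :
    set ('rV[R]_n * 'rV[R]_K.+1 * 'rV[R]_J.+1) :=
  [set q : 'rV[R]_n * 'rV[R]_K.+1 * 'rV[R]_J.+1 | let: (x, gam, z) := q in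
    [/\ binary x, binary gam, (forall j, z 0 j <= 0),
        (forall j, - z 0 j - \sum_(k < K.+1) r k * gam 0 k
                     >= d j * dot x (xibar j) + d0 j)
      & \sum_(k < K.+1) gam 0 k = 1]].

Definition tau (R : realType) J K (d0 d : 'I_J.+1 -> R) (r : 'I_K.+1 -> R)
    (j : 'I_J.+1) (k : 'I_K.+1) : int :=
  Num.ceil (- ((r k + d0 j) / d j)).

Definition nu (R : realType) J K (d0 d : 'I_J.+1 -> R) (r : 'I_K.+1 -> R)
    (j : 'I_J.+1) (k : 'I_K.+1) : R :=
  - ((r k + d0 j) / d j) - ((tau d0 d r j k)%:~R - 1).

(* nu^j_1 for the 1-based index j in {0, .., J.+1}, with nu^0_1 := 0. *)
Definition nu1 (R : realType) J K (d0 d : 'I_J.+1 -> R) (r : 'I_K.+1 -> R)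
    (j : nat) : R :=
  if j is j'.+1 then nu d0 d r (inord j') ord0 else 0.

Definition alpha (R : realType) J K (d0 d : 'I_J.+1 -> R) (r : 'I_K.+1 -> R)
    (k : 'I_K.+1) : R :=
  pos_part
    (min_ord (fun j => Num.min (nu d0 d r j k - nu d0 d r ord_max ord0) 0)
     + \sum_(j < J.+1) (nu1 d0 d r j.+1 - nu1 d0 d r j)
         * ((tau d0 d r j k)%:~R - (tau d0 d r j ord0)%:~R)).

(* Main.v *)
Require Import Defs.
From HB Require Import structures.
From mathcomp Require Import all_boot all_order all_algebra.
From mathcomp Require Import all_classical all_reals all_analysis.
From mathcomp Require Import ring lra.

Import Order.TTheory GRing.Theory Num.Theory.
Local Open Scope classical_set_scope.
Local Open Scope ring_scope.

(** The inequality is a lifted mixing inequality.  Since [gam] is binary and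
sums to one, it selects a single radius [r k], and the point satisfies
[z j / d j >= nu j k + s j - 1] with the integer
[s j = tau j k - dot x (xibar j)], because dividing by [d j < 0] reverses
the constraint.  As [z <= 0], also [z j / d j >= 0].  Put
[M = max_j z j / d j] and let [c j = nu1 j.+1 - nu1 j]: these weights are
nonnegative and telescope to [nu ord_max ord0 <= 1].  The right-hand side is
[\sum_j c j * (tau j ord0 - dot x (xibar j)) + alpha k], and the two values
that the positive part [alpha k] can take are treated separately.

If [alpha k = 0], only the smallest radius matters: [r k >= r ord0], so the
constraint for [k] implies the one for [ord0], and the claim is the classical
mixing inequality [mixing_inequality].

If [alpha k] is the expression inside the positive part, its sum turns every
[tau j ord0] into [tau j k], so the claim reads [\sum_j c j * s j + mu <= M]
where [mu <= 0] is the minimum in [alpha k].  The fractional parts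
[nu j k] need no longer be sorted in [j], which spoils the mixing argument;
the correction [mu <= nu j k - nu ord_max ord0] pays for that, by
[corrected_mixing_inequality]. *)

(** * Mixing inequalities *)

(** Ties are broken in favour of the largest index, so that integrality gives
a gap of at least one for every later index. *)
Lemma last_maximizer J (s : 'I_J.+1 -> int) :
  exists j0 : 'I_J.+1, (forall j, s j <= s j0) /\
    (forall j : 'I_J.+1, (j0 < j)%N -> s j <= s j0 - 1).
Proof.
have [j1 _ max_j1] := @arg_maxP _ _ 'I_J.+1 ord0 xpredT s isT.
have s_max j : s j <= s j1 by exact: max_j1.
have [j0 /eqP s_j0 j_max] :=
  @arg_maxnP 'I_J.+1 j1 (fun j => s j == s j1) (fun j => j) (eqxx _).
exists j0; rewrite s_j0; split=> // j j0_lt.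
rewrite lerBrDr -[_ + 1]addrC lez1D lt_neqAle s_max // andbT.
by apply: contraTN j0_lt => /j_max; rewrite -leqNgt.
Qed.

Section Mixing.
Variables (R : realType) (J : nat) (u : nat -> R) (s : 'I_J.+1 -> int) (M : R).
Hypotheses (u0 : u 0 = 0) (u_sorted : forall j : 'I_J.+1, u j <= u j.+1).
Hypotheses (u_le1 : u J.+1 <= 1) (M_ge0 : 0 <= M).

Local Notation mixed_sum := (\sum_(j < J.+1) (u j.+1 - u j) * (s j)%:~R).

Lemma sum_increments k : (\sum_(j < k) (u j.+1 - u j)) = u k.
Proof.
by rewrite -(big_mkord xpredT (fun j => u j.+1 - u j)) telescope_sumr // u0 subr0.
Qed.

Lemma mixed_sum_le (t : int) :
  (forall j, s j <= t) -> mixed_sum <= u J.+1 * t%:~R.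
Proof.
move=> s_le; rewrite -sum_increments mulr_suml ler_sum // => j _.
by rewrite ler_wpM2l ?subr_ge0 // ler_int.
Qed.

Lemma u_last_ge0 : 0 <= u J.+1.
Proof. by rewrite -sum_increments sumr_ge0 // => j _; rewrite subr_ge0. Qed.

(** At the last maximizer [j0] of [s], the weights up to [j0] telescope to
[u j0.+1] and multiply at most [s j0]; later weights multiply at most
[s j0 - 1].  The total is at most [u j0.+1 + u J.+1 * (s j0 - 1)], which the
[j0]-th constraint bounds by [M] when [s j0 >= 1].  When [s j0 <= 0] the sum is
nonpositive. *)
Lemma mixing_inequality :
  (forall j : 'I_J.+1, u j.+1 + (s j)%:~R - 1 <= M) -> mixed_sum <= M.
Proof.
move=> M_ge; have [j0 [s_max s_gap]] := last_maximizer _ s.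
have [s_le0|s_gt0] := lerP (s j0) 0.
  apply: le_trans (mixed_sum_le _ s_max) _; apply: le_trans M_ge0.
  by rewrite mulr_ge0_le0 ?u_last_ge0 // lerz0.
have sm1_ge0 : 0 <= (s j0)%:~R - 1 :> R by rewrite subr_ge0 ler1z -gtz0_ge1.
suff sum_le : mixed_sum <= u j0.+1 + u J.+1 * ((s j0)%:~R - 1).
  have := M_ge j0; have := ler_wpM2r sm1_ge0 u_le1; lra.
have -> : u j0.+1 = \sum_(j < J.+1 | (j < j0.+1)%N) (u j.+1 - u j).
  by rewrite -(big_ord_widen _ (fun j => u j.+1 - u j)) ?sum_increments.
rewrite -sum_increments mulr_suml [X in _ <= X + _]big_mkcond -big_split /= ler_sum // => j _.
have c_ge0 : 0 <= u j.+1 - u j by rewrite subr_ge0.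
rewrite ltnS; case: leqP => [_|/s_gap].
  have : (s j)%:~R <= (s j0)%:~R :> R by rewrite ler_int.
  by move/(ler_wpM2l c_ge0); lra.
by rewrite -(ler_int R) intrB add0r => /(ler_wpM2l c_ge0).
Qed.

(** Here the constraints use offsets [w] unrelated to the order of [u].  With [j0]
a maximizer of [s], the sum is at most
[u J.+1 * s j0 = u J.+1 + u J.+1 * (s j0 - 1)], and adding [mu] trades the first
[u J.+1] for [w j0]; the [j0]-th constraint then gives the bound when
[s j0 >= 1].  When [s j0 <= 0] both the sum and [mu] are nonpositive. *)
Lemma corrected_mixing_inequality (w : 'I_J.+1 -> R) (mu : R) :
  (forall j, w j + (s j)%:~R - 1 <= M) ->
  mu <= 0 -> (forall j, mu <= w j - u J.+1) -> mixed_sum + mu <= M.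
Proof.
move=> M_ge mu_le0 mu_le; have [j0 [s_max _]] := last_maximizer _ s.
have := mixed_sum_le _ s_max.
have [s_le0|s_gt0] := lerP (s j0) 0.
  have : u J.+1 * (s j0)%:~R <= 0 by rewrite mulr_ge0_le0 ?u_last_ge0 // lerz0.
  by move: M_ge0; lra.
have sm1_ge0 : 0 <= (s j0)%:~R - 1 :> R by rewrite subr_ge0 ler1z -gtz0_ge1.
have := ler_wpM2r sm1_ge0 u_le1; have := M_ge j0; have := mu_le j0; lra.
Qed.

End Mixing.

(** * Binary vectors *)

Lemma binary_sum1_selects (R : realType) K (gam : 'rV[R]_K) :
  binary gam -> \sum_k gam 0 k = 1 ->
  exists k, forall f : 'I_K -> R, \sum_i f i * gam 0 i = f k.
Proof.
move=> gam_bin sum1.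
have gam_ge0 i : 0 <= gam 0 i by case: (gam_bin 0 i) => ->.
have [k gamk] : exists k, gam 0 k = 1.
  apply: contrapT => none; have /eqP := sum1; rewrite big1 => [|i _].
    by rewrite eq_sym oner_eq0.
  by case: (gam_bin 0 i) => // gami; case: none; exists i.
have rest0 : \sum_(i < K | i != k) gam 0 i = 0.
  by move: sum1; rewrite (bigD1 k) //= gamk; lra.
exists k => f; rewrite (bigD1 k) //= gamk mulr1 big1 ?addr0 // => i ik.
by rewrite (psumr_eq0P _ rest0) ?mulr0.
Qed.

Lemma dot_binary_int (R : realType) n (x y : 'rV[R]_n) :
  binary x -> binary y -> exists t : int, dot x y = t%:~R.
Proof.
move=> x_bin y_bin; apply/intrP; rewrite /dot mxE rpred_sum // => i _.
rewrite mxE rpredM //.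
  by case: (x_bin 0 i) => ->; rewrite ?rpred0 ?rpred1.
by case: (y_bin 0 i) => ->; rewrite ?rpred0 ?rpred1.
Qed.

(** * Validity of the lifted inequality *)

Theorem theorem4 (R : realType) (n m N J K : nat)
    (delta eps p : R) (v : 'I_m.+1 -> int)
    (xihat : 'I_N.+1 -> 'M[R]_(m.+1, n))
    (d0 d : 'I_J.+1 -> R) (xibar : 'I_J.+1 -> 'rV[R]_n)
    (r : 'I_K.+1 -> R)
    (delta_gt0 : 0 < delta) (eps_gt0 : 0 < eps) (eps_lt1 : eps < 1)
    (p_ge1 : 1 <= p) (v_ge1 : forall i, 1 <= v i)
    (xihat_bin : forall s, binary (xihat s))
    (d_lt0 : forall j, d j < 0) (xibar_bin : forall j, binary (xibar j))
    (r_inj : injective r)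
    (r_range : range r = radii delta eps p v xihat)
    (r_min : forall k, r ord0 <= r k)
    (nu1_sorted : forall j : 'I_J.+1, nu1 d0 d r j.+1 >= nu1 d0 d r j) :
  forall (x : 'rV[R]_n) (gam : 'rV[R]_K.+1) (z : 'rV[R]_J.+1),
    S_B d0 d xibar r (x, gam, z) ->
    max_ord (fun j => z 0 j / d j) >=
      \sum_(j < J.+1) (nu1 d0 d r j.+1 - nu1 d0 d r j)
          * ((tau d0 d r j ord0)%:~R - dot x (xibar j))
      + \sum_(k < K.+1) alpha d0 d r k * gam 0 k.
Proof.
move=> x gam z [x_bin gam_bin z_le0 z_con gam_sum].
have [k gam_k] := binary_sum1_selects _ _ _ gam_bin gam_sum.
set M := max_ord _.
have le_M j : z 0 j / d j <= M by rewrite /M /max_ord; apply: le_bigmax.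
have M_ge0 : 0 <= M.
  by apply: le_trans (le_M ord0); rewrite mulr_le0 // invr_le0 ltW.
have [t dot_t] : exists t, forall j, dot x (xibar j) = (t j)%:~R.
  have /choice [t] : forall j, exists t : int, dot x (xibar j) = t%:~R.
    by move=> j; apply: dot_binary_int.
  by exists t.
have M_ge j : nu d0 d r j k + (tau d0 d r j k - t j)%:~R - 1 <= M.
  apply: le_trans (le_M j); have := z_con j; rewrite gam_k dot_t => con.
  rewrite ler_ndivlMr // /nu intrB.
  have -> : (- ((r k + d0 j) / d j) - ((tau d0 d r j k)%:~R - 1)
     + ((tau d0 d r j k)%:~R - (t j)%:~R) - 1) * d j
     = - (r k + d0 j) - d j * (t j)%:~R by field; rewrite lt_eqF.
  lra.
have nu1S (j : 'I_J.+1) : nu1 d0 d r j.+1 = nu d0 d r j ord0.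
  by rewrite /= inord_val.
have nu1_last : nu1 d0 d r J.+1 = nu d0 d r ord_max ord0 by rewrite -nu1S.
have nu1_le1 : nu1 d0 d r J.+1 <= 1.
  have := ceil_ge (- ((r ord0 + d0 ord_max) / d ord_max)).
  by rewrite nu1_last /nu /tau; lra.
rewrite gam_k /alpha /pos_part; set mu := min_ord _.
have mu_le j : mu <= Num.min (nu d0 d r j k - nu d0 d r ord_max ord0) 0.
  by rewrite /mu /min_ord; apply: bigmin_le_cond.
case: (leP (mu + _) 0) => _.
  rewrite addr0; under eq_bigr do rewrite dot_t -intrB.
  apply: mixing_inequality => // j; apply: le_trans (M_ge j).
  rewrite nu1S /nu !intrB.
  have : (r k + d0 j) / d j <= (r ord0 + d0 j) / d j.
    by rewrite ler_nM2r ?invr_lt0 // lerD2r.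
  lra.
rewrite addrCA -big_split /= addrC.
under eq_bigr => j _ do
  rewrite -mulrDr dot_t -!intrB -intrD [_ + (_ - _)]addrC subrKA.
apply: (@corrected_mixing_inequality _ _ _ _ _ _ _ _ _ (nu d0 d r ^~ k)) => //.
  by move: (mu_le ord0); rewrite le_min => /andP[].
by move=> j; rewrite nu1_last; move: (mu_le j); rewrite le_min => /andP[].
Qed.
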